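(* Let $SF$ be a $(1|1)$-supermanifold with coordinate transformations $$\xi'=g^{(\alpha,\beta)}_{v',v}(w)\big(\xi+\beta_{v',v}(w)\big),\qquad w'=f^{(\alpha,\beta)}_{v',v}\big(w+\xi\alpha_{v',v}(w)\big)$$ on the overlaps $U_v\cap U_{v'}$. Then the coordinate transformations for the dual manifold $\widetilde{SF}$ of $(0|1)$-divisors of $SF$, in the coordinates $(a,\zeta)$, are given by $$\zeta'=g^{(\alpha,\beta)}_{v,v'}(a)\,\partial_a f^{(\alpha,\beta)}_{v',v}(a)\Big(s_{v,v'}(a)\,\zeta-\alpha_{v',v}(a)\Big),$$ $$s_{v,v'}(a)=1-g^{(\alpha,\beta)}_{v,v'}(a)\,\partial_a\big(g^{(\alpha,\beta)}_{v',v}(a)\beta_{v',v}(a)\big)\,\alpha_{v',v}(a),$$ $$a'=f^{(\alpha,\beta)}_{v',v}\Big(a-\big(1-\partial_a\beta_{v',v}(a)\,\alpha_{v',v}(a)\big)\zeta\,\beta_{v',v}(a)+\alpha_{v',v}(a)\beta_{v',v}(a)\Big).$$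
   Context: $SF$ is a complex $(1|1)$-supermanifold over a Grassmann algebra, with charts over open sets $U_v$ (indexed by the vertices $v$ of a fatgraph) with coordinates $(w,\xi)$ ($w$ even, $\xi$ odd) on $U_v$ and $(w',\xi')$ on $U_{v'}$. Here $f^{(\alpha,\beta)}_{v',v}$ and $g^{(\alpha,\beta)}_{v',v}$ are even holomorphic functions on the overlaps ($g^{(\alpha,\beta)}_{v',v}$ and $\partial_w f^{(\alpha,\beta)}_{v',v}$ invertible), $\alpha_{v',v},\beta_{v',v}$ are odd holomorphic functions, and $g^{(\alpha,\beta)}_{v,v'}(a)=1/g^{(\alpha,\beta)}_{v',v}(a)$. The dual supermanifold $\widetilde{SF}$ is the $(1|1)$-supermanifold parametrizing $(0|1)$-dimensional divisors of $SF$. In the chart with coordinates $(w,\xi)$ a $(0|1)$-divisor is given by the equation $w=a+\zeta\xi$, where $(a,\zeta)$ ($a$ even, $\zeta$ odd) are the coordinates on $\widetilde{SF}$; in the chart $(w',\xi')$ the same divisor is $w'=a'+\zeta'\xi'$. *)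

(* Defs.v *)
From HB Require Import structures.
From mathcomp Require Import all_boot all_order all_algebra.
From mathcomp Require Import complex.
Set Implicit Arguments.
Unset Strict Implicit.
Unset Printing Implicit Defensive.
Import Order.TTheory GRing.Theory Num.Theory.
Local Open Scope ring_scope.

(** Grassmann algebras:

  [grassmann K n] is the exterior algebra over [K] on the odd generators
  [theta_0, ..., theta_(n-1)]. An element is the family of its coordinates in
  the basis [e_S = theta_i1 * ... * theta_ik], [S = {i1 < ... < ik}], and
  [e_A * e_B = (-1)^(ninv A B) e_(A :|: B)] if [A] and [B] are disjoint,
  [e_A * e_B = 0] otherwise. *)

Definition grassmann (K : comNzRingType) (n : nat) : Type :=
  {ffun {set 'I_n} -> K}.

HB.instance Definition _ (K : comNzRingType) n :=
  GRing.Lmodule.copy (grassmann K n) {ffun {set 'I_n} -> K^o}.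

Definition ninv n (A B : {set 'I_n}) : nat :=
  \sum_(i in A) \sum_(j in B) (j < i)%N.

Section GrassmannRing.
Variables (K : comNzRingType) (n : nat).
Implicit Types x y z : grassmann K n.

Definition gone : grassmann K n := [ffun S => (S == set0)%:R].

Definition gmul x y : grassmann K n :=
  [ffun S : {set 'I_n} =>
    \sum_(A : {set 'I_n} | A \subset S)
       (-1) ^+ ninv A (S :\: A) * x A * y (S :\: A)].

Lemma ninvUl (A B D : {set 'I_n}) :
  [disjoint A & B] -> ninv (A :|: B) D = (ninv A D + ninv B D)%N.
Proof.
by move=> dAB; rewrite /ninv -bigU //=; apply: eq_bigl => i; rewrite !inE.
Qed.

Lemma ninvUr (A B D : {set 'I_n}) :
  [disjoint B & D] -> ninv A (B :|: D) = (ninv A B + ninv A D)%N.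
Proof.
move=> dBD; rewrite /ninv -big_split; apply: eq_bigr => i _.
by rewrite -bigU //=; apply: eq_bigl => j; rewrite !inE.
Qed.

Lemma ninv0s (A : {set 'I_n}) : ninv set0 A = 0%N.
Proof. by rewrite /ninv big_set0. Qed.

Lemma ninvs0 (A : {set 'I_n}) : ninv A set0 = 0%N.
Proof. by rewrite /ninv big1 // => i _; rewrite big_set0. Qed.

Lemma gmulA : associative gmul.
Proof.
move=> x y z; apply/ffunP => S; rewrite !ffunE.
pose F (A B : {set 'I_n}) : K :=
  (-1) ^+ ninv A (S :\: A) * x A *
  ((-1) ^+ ninv (B :\: A) (S :\: B) * y (B :\: A) * z (S :\: B)).
transitivity (\sum_(A : {set 'I_n} | A \subset S)
    \sum_(B : {set 'I_n} | (A \subset B) && (B \subset S)) F A B).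
  apply: eq_bigr => A sAS; rewrite ffunE big_distrr /=.
  rewrite (reindex_onto (fun B : {set 'I_n} => B :\: A)
    (fun D : {set 'I_n} => A :|: D)) /=; last first.
    move=> D; rewrite subsetD disjoint_sym => /andP[_ dAD].
    by rewrite setDUl setDv set0U; apply/setDidPl; rewrite disjoint_sym.
  apply: eq_big => [B|B /andP[_ /eqP eB]].
    have -> : A :|: (B :\: A) = A :|: B.
      by apply/setP => i; rewrite !inE; case: (i \in A).
    have -> : (A :|: B == B) = (A \subset B) by apply/eqP/setUidPr.
    rewrite andbC; case: (boolP (A \subset B)) => //= sAB.
    suff eS : A :|: (S :\: A) = S by rewrite subDset eS.
    apply/setP => i; rewrite !inE.
    by case: (boolP (i \in A)) => //= /(subsetP sAS) ->.
  rewrite /F; congr (_ * (_ ^+ ninv _ _ * _ * z _)).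
    by rewrite setDDl eB.
  by rewrite setDDl eB.
rewrite (exchange_big_dep (fun B : {set 'I_n} => B \subset S)) /=; last first.
  by move=> A B _ /andP[].
apply: eq_bigr => B sBS; rewrite ffunE big_distrr big_distrl /=.
apply: eq_big => [A|A /andP[_ /andP[sAB _]]].
  by apply/andP/idP => [[_ /andP[]]|sAB]//; rewrite sAB (subset_trans sAB).
have eS : S :\: A = (B :\: A) :|: (S :\: B).
  by rewrite -{1}(setID S B) setDUl (setIidPr sBS) setDDl (setUidPl sAB).
have dBS : [disjoint B :\: A & S :\: B].
  rewrite -setI_eq0 -subset0; apply/subsetP => i; rewrite !inE.
  by case: (i \in B); rewrite ?andbF.
have dA : [disjoint A & B :\: A].
  rewrite -setI_eq0 -subset0; apply/subsetP => i; rewrite !inE.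
  by case: (i \in A); rewrite ?andbF.
have -> : ninv B (S :\: B) = (ninv A (S :\: B) + ninv (B :\: A) (S :\: B))%N.
  rewrite -ninvUl //; congr (ninv _ _).
  by rewrite -{1}(setID B A) (setIidPr sAB).
rewrite /F eS ninvUr // !exprD -!mulrA; set a := (-1) ^+ _; set b := (-1) ^+ _.
set c := (-1) ^+ _.
by rewrite [c * (a * _)]mulrCA [b * (a * _)]mulrCA [c * (x A * _)]mulrCA.
Qed.

Lemma gmul1l : left_id gone gmul.
Proof.
move=> x; apply/ffunP => S; rewrite ffunE (bigD1 set0) ?sub0set //=.
rewrite big1 ?addr0 => [|A /andP[_ /negPf nA]]; last first.
  by rewrite !ffunE nA mulr0 mul0r.
by rewrite ffunE eqxx ninv0s setD0 expr0 !mul1r.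
Qed.

Lemma gmul1r : right_id gone gmul.
Proof.
move=> x; apply/ffunP => S; rewrite ffunE (bigD1 S) //=.
rewrite big1 ?addr0 => [|A /andP[sAS nA]]; last first.
  rewrite !ffunE setD_eq0; suff /negPf-> : ~~ (S \subset A) by rewrite mulr0.
  by apply: contra nA => sSA; rewrite eqEsubset sAS.
by rewrite ffunE setDv eqxx ninvs0 expr0 mul1r mulr1.
Qed.

Lemma gmulDl : left_distributive gmul +%R.
Proof.
move=> x y z; apply/ffunP => S; rewrite !ffunE -big_split /=.
by apply: eq_bigr => A _; rewrite !ffunE mulrDr mulrDl.
Qed.

Lemma gmulDr : right_distributive gmul +%R.
Proof.
move=> x y z; apply/ffunP => S; rewrite !ffunE -big_split /=.
by apply: eq_bigr => A _; rewrite !ffunE mulrDr.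
Qed.

Lemma gone_neq0 : gone != 0.
Proof.
apply/eqP => /ffunP /(_ set0); rewrite !ffunE eqxx.
by apply/eqP; rewrite oner_eq0.
Qed.

HB.instance Definition _ := GRing.Zmodule_isNzRing.Build (grassmann K n)
  gmulA gmul1l gmul1r gmulDl gmulDr gone_neq0.

Lemma gscaleAl (a : K) x y : a *: (x * y) = (a *: x) * y.
Proof.
apply/ffunP => S; rewrite !ffunE [LHS]mulr_sumr.
apply: eq_bigr => A _; rewrite !ffunE /GRing.scale /=.
by rewrite [_ * (a * _)]mulrCA !mulrA.
Qed.

HB.instance Definition _ :=
  GRing.Lmodule_isLalgebra.Build K (grassmann K n) gscaleAl.

Lemma gscaleAr (a : K) x y : a *: (x * y) = x * (a *: y).
Proof.
apply/ffunP => S; rewrite !ffunE [LHS]mulr_sumr.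
apply: eq_bigr => A _; rewrite !ffunE /GRing.scale /=.
by rewrite [RHS]mulrCA.
Qed.

HB.instance Definition _ :=
  GRing.Lalgebra_isAlgebra.Build K (grassmann K n) gscaleAr.

Definition gbody x : K := x set0.

Definition geven x : Prop := forall S : {set 'I_n}, odd #|S| -> x S = 0.

Definition godd x : Prop := forall S : {set 'I_n}, ~~ odd #|S| -> x S = 0.

End GrassmannRing.

(** The [i]-th generator; it is [0] when [n <= i]. *)
Definition theta (K : comNzRingType) (n i : nat) : grassmann K n :=
  [ffun S : {set 'I_n} =>
    ((i < n)%N && (S == [set j : 'I_n | val j == i]%SET))%:R].

(** The substitution [theta_i |-> eta i]. The product is taken in increasing
  order of [i]; this is an algebra morphism when every [eta i] is odd. *)
Definition gsubst (K : comNzRingType) (n m : nat) (eta : 'I_n -> grassmann K m)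
    (x : grassmann K n) : grassmann K m :=
  \sum_(S : {set 'I_n}) x S *: \prod_(i in S) eta i.

(** The inclusion of Grassmann algebras, meaningful for [n <= m]. *)
Definition ginc (K : comNzRingType) (n m : nat) :
    grassmann K n -> grassmann K m :=
  gsubst (fun i : 'I_n => theta K m i).

From mathcomp Require Import all_classical all_reals.
From mathcomp Require Import topology normedtype derive.
Import numFieldNormedType.Exports.
Local Open Scope classical_set_scope.

Section GrassmannUnits.
Variables (K : comNzRingType) (n : nat).
Implicit Types x y : grassmann K n.

Definition gunit : pred (grassmann K n) :=
  fun x => `[< exists y, y * x = 1 /\ x * y = 1 >].

Definition ginverse x : grassmann K n :=
  xget x [set y | y * x = 1 /\ x * y = 1].

Lemma ginverseP x : gunit x -> ginverse x * x = 1 /\ x * ginverse x = 1.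
Proof.
move=> /asboolP [y hy]; rewrite /ginverse.
by case: xgetP => [_ -> //|/(_ y)]; case.
Qed.

Lemma gmulVr : {in gunit, left_inverse 1 ginverse *%R}.
Proof. by move=> x /ginverseP[]. Qed.

Lemma gdivrr : {in gunit, right_inverse 1 ginverse *%R}.
Proof. by move=> x /ginverseP[]. Qed.

Lemma gunitP x y : y * x = 1 /\ x * y = 1 -> gunit x.
Proof. by move=> h; apply/asboolP; exists y. Qed.

Lemma ginverse_out : {in [predC gunit], ginverse =1 id}.
Proof.
move=> x /negP nx; rewrite /ginverse; case: xgetP => [y _ h|//].
by case: nx; apply: (@gunitP x y).
Qed.

HB.instance Definition _ := GRing.NzRing_hasMulInverse.Build (grassmann K n)
  gmulVr gdivrr gunitP ginverse_out.

End GrassmannUnits.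

(** Giving [R[i]] the type [numFieldType] selects its topology and its normed
  module structure over itself, so that [derivable] and [derive1n] below are
  the complex notions. *)
Definition Cplx (R : realType) : numFieldType := R[i].

Notation Lambda R n := (grassmann (Cplx R) n).

Section Holomorphic.
Variables (R : realType) (n : nat).
Implicit Types (D : set (Cplx R)) (F : Cplx R -> Lambda R n).

(** To be used with [D] open. *)
Definition holomorphic_on D F : Prop :=
  forall z, D z -> forall S, derivable (fun u : Cplx R => F u S) z 1.

Definition gderiv (k : nat) F : Cplx R -> Lambda R n :=
  fun z => [ffun S => ((fun u : Cplx R => F u S)^`(k)) z].

(** Value of [F] at an even element [w] whose body lies in the domain of [F],
  the generators [theta_i] of the coefficients of [F] being sent to [eta i]:
  the Taylor expansion of [F] at the body of [w], which is a finite sum because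
  the (m+1)-st power of [w - gbody w] is [0]. *)
Definition geval m (eta : 'I_n -> Lambda R m) F (w : Lambda R m) :
    Lambda R m :=
  \sum_(k < m.+1) (k`!%:R)^-1 *:
    (gsubst eta (gderiv k F (gbody w)) * (w - (gbody w)%:A) ^+ k).

(** [F(w)] for [w] in a Grassmann algebra with [m >= n] generators. *)
Definition gext m F (w : Lambda R m) : Lambda R m :=
  geval (fun i : 'I_n => theta (Cplx R) m i) F w.

End Holomorphic.

(** (1|1)-supermanifolds over a Grassmann algebra:

  A function of the coordinates [(w, xi)] over [Lambda R N], that is an element
  of [O(D) (x) Lambda R N (x) Lambda[xi]], is represented as a holomorphic map
  from [D] to [Lambda R N.+1] in which the last generator, of index [N], plays
  the role of [xi]. Its parity is the parity of its values. *)

(** Value at a point [(w, xi)], [w] even and [xi] odd, with coordinates in a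
  Grassmann algebra with [m >= N] generators. *)
Definition seval (R : realType) (N m : nat) (F : Cplx R -> Lambda R N.+1)
    (w xi : Lambda R m) : Lambda R m :=
  geval (fun i : 'I_N.+1 => if (i < N)%N then theta (Cplx R) m i else xi) F w.

(** The atlas [(U_v, w_v)] of the underlying Riemann surface. That the changes
  of coordinates are holomorphic is part of [superManifold], where they are the
  bodies of the transition functions. *)
Record bodyAtlas (R : realType) (X : topologicalType) (V : Type) := BodyAtlas {
  chart_dom : V -> set X;
  chart_coord : V -> X -> Cplx R;
  atlas_hausdorff : hausdorff_space X;
  chart_dom_open : forall v, open (chart_dom v);
  chart_dom_cover : \bigcup_v chart_dom v = setT;
  chart_coord_inj : forall v x y, chart_dom v x -> chart_dom v y ->
    chart_coord v x = chart_coord v y -> x = y;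
  chart_coord_continuous : forall v, {in chart_dom v, continuous (chart_coord v)};
  chart_coord_open : forall v (A : set X),
    A `<=` chart_dom v -> open A -> open (chart_coord v @` A)
}.

(** The image of the overlap of [U_v] and [U_v'] in the coordinate of [U_v]. *)
Definition overlap (R : realType) (X : topologicalType) (V : Type)
    (A : bodyAtlas R X V) (v' v : V) : set (Cplx R) :=
  chart_coord A v @` (chart_dom A v `&` chart_dom A v').

(** [trans_even v' v] and [trans_odd v' v] express the coordinates
  [(w', xi')] of [U_v'] as functions of the coordinates [(w, xi)] of [U_v]. *)
Record superManifold (R : realType) (N : nat) (X : topologicalType) (V : Type)
    (A : bodyAtlas R X V) := SuperManifold {
  trans_even : V -> V -> Cplx R -> Lambda R N.+1;
  trans_odd : V -> V -> Cplx R -> Lambda R N.+1;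
  trans_even_holo : forall v' v,
    holomorphic_on (overlap A v' v) (trans_even v' v);
  trans_odd_holo : forall v' v,
    holomorphic_on (overlap A v' v) (trans_odd v' v);
  trans_even_even : forall v' v z, overlap A v' v z -> geven (trans_even v' v z);
  trans_odd_odd : forall v' v z, overlap A v' v z -> godd (trans_odd v' v z);
  trans_body : forall v' v x, chart_dom A v x -> chart_dom A v' x ->
    gbody (trans_even v' v (chart_coord A v x)) = chart_coord A v' x;
  trans_even_id : forall v z, overlap A v v z -> trans_even v v z = z%:A;
  trans_odd_id : forall v z, overlap A v v z ->
    trans_odd v v z = theta (Cplx R) N.+1 N;
  trans_even_cocycle : forall v'' v' v x,
    chart_dom A v x -> chart_dom A v' x -> chart_dom A v'' x ->
    let z := chart_coord A v x in
    trans_even v'' v z =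
      seval (trans_even v'' v') (trans_even v' v z) (trans_odd v' v z);
  trans_odd_cocycle : forall v'' v' v x,
    chart_dom A v x -> chart_dom A v' x -> chart_dom A v'' x ->
    let z := chart_coord A v x in
    trans_odd v'' v z =
      seval (trans_odd v'' v') (trans_even v' v z) (trans_odd v' v z)
}.

(** The point [(w, xi)] lies on the (0|1)-divisor [w = a + zeta xi]. *)
Definition on_divisor (R : realType) (m : nat) (a zeta w xi : Lambda R m) :
    Prop :=
  w = a + zeta * xi.

(** [SD], with the same underlying charts as [SF] and with coordinates
  [(a, zeta)] and transition functions [a' = a'(a, zeta)],
  [zeta' = zeta'(a, zeta)], parametrizes the (0|1)-divisors of [SF]: on each
  overlap, the equations [w = a + zeta xi] in the chart [v] and
  [w' = a' + zeta' xi'] in the chart [v'] define the same divisor.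

  Here [(a, zeta)] are the coordinates of [SD] themselves: [a] is a complex
  number [z] and [zeta] is the generator of index [N], as in the representation
  of functions on [SD]. Equality of divisors is equality of their points
  [(w, xi)] with coordinates in every Grassmann algebra [Lambda R m] that
  contains the coefficients and [zeta]. *)
Definition is_dual (R : realType) (N : nat) (X : topologicalType) (V : Type)
    (A : bodyAtlas R X V) (SF SD : superManifold N A) : Prop :=
  forall v' v z, overlap A v' v z ->
  forall m, (N < m)%N ->
  forall w xi : Lambda R m, geven w -> godd xi -> overlap A v' v (gbody w) ->
    on_divisor z%:A (theta (Cplx R) m N) w xi <->
    on_divisor (ginc m (trans_even SD v' v z)) (ginc m (trans_odd SD v' v z))
      (seval (trans_even SF v' v) w xi) (seval (trans_odd SF v' v) w xi).

(* Main.v *)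
(** On the chart of [v], a point [(w, xi)] of the divisor [w = a + zeta xi] is
  mapped to a point satisfying [w' = a' + zeta' xi'] exactly when
  [E(w, xi) = w'(w, xi) - a' - zeta' xi'(w, xi)] vanishes. At [w = a + zeta xi]
  the second order Taylor terms vanish since [(zeta xi) ^ 2 = 0], and first
  derivatives of the [xi]-dependent terms vanish since [xi ^ 2 = 0]; so
  [E(a + zeta xi, xi)] involves only [f], [f'], [g beta], [(g beta)'] and
  [alpha], and a direct computation shows that the claimed [(a', zeta')] make it
  [0] for all [xi]. They are the only such pair: take [xi = 0] and [xi] a
  new generator. Conversely, by Taylor expansion
  [E(w, xi) - E(a + zeta xi, xi) = U (w - a - zeta xi)], where [U] has body
  [f'(a) <> 0]. *)

Require Import Defs.
From HB Require Import structures.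
From mathcomp Require Import all_boot all_order all_algebra.
Set Implicit Arguments.
Unset Strict Implicit.
Unset Printing Implicit Defensive.
Import GRing.Theory Num.Theory.
Local Open Scope ring_scope.

(** * Supercommutativity *)

(** Disjointness rules out equal indices, so each pair of [A] and [B] is an inversion in exactly one
    of the two orders. *)
Lemma ninv_swap n (A B : {set 'I_n}) :
  [disjoint A & B] -> (ninv A B + ninv B A = #|A| * #|B|)%N.
Proof.
move=> dAB; rewrite /ninv [X in (_ + X)%N]exchange_big /= -big_split /=.
rewrite -sum_nat_const; apply: eq_bigr => i iA.
rewrite -big_split /= -sum1_card; apply: eq_bigr => j jB.
have: (i : nat) != j.
  by apply: contraTneq jB => /val_inj <-; rewrite (disjointFr dAB).
by case: ltngtP.
Qed.

Section Grassmann.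
Variables (K : numFieldType) (n : nat).
Implicit Types (x y : grassmann K n) (A B S : {set 'I_n}) (b c : bool).

Lemma grassmannP x y : (forall S, x S = y S) -> x = y.
Proof. by move=> h; apply/ffunP. Qed.

Lemma gcoefD x y S : (x + y) S = x S + y S. Proof. exact: ffunE. Qed.

Lemma gcoefZ (k : K) x S : (k *: x) S = k * x S. Proof. exact: ffunE. Qed.

Lemma gcoef0 S : (0 : grassmann K n) S = 0. Proof. exact: ffunE. Qed.

Lemma gcoef_sum (I : Type) (r : seq I) (P : pred I) (F : I -> grassmann K n) S :
  (\sum_(i <- r | P i) F i) S = \sum_(i <- r | P i) F i S.
Proof.
by apply: (big_morph (fun x => x S) (fun x y => gcoefD x y S) (gcoef0 S)).
Qed.

Lemma grassmannE x y S : (x * y) S =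
  \sum_(A : {set 'I_n} | A \subset S)
    (-1) ^+ ninv A (S :\: A) * x A * y (S :\: A).
Proof. by rewrite [LHS]ffunE. Qed.

(** Reindexing by [A |-> S :\: A] aligns [y * x] termwise with [x * y]; by [ninv_swap] the two signs
    differ by the parity of [#|A| * #|S :\: A|]. All commutation rules are read off from this. *)
Lemma grassmann_swapE x y S : (y * x) S =
  \sum_(A : {set 'I_n} | A \subset S) (-1) ^+ (#|A| * #|S :\: A|) *
    ((-1) ^+ ninv A (S :\: A) * x A * y (S :\: A)).
Proof.
rewrite grassmannE (reindex_onto (fun A => S :\: A) (fun A => S :\: A)) /=.
  apply: eq_big => [A|A /andP[sAS /eqP eA]]; last first.
    rewrite eA -ninv_swap; last first.
      by rewrite -setI_eq0 setIDA setIC setDIl setDv setI0.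
    rewrite exprD !mulrA -[RHS]mulrA [x A * _]mulrC mulrA; congr (_ * _ * _).
    by rewrite mulrAC -expr2 sqrr_sign mul1r.
  rewrite subsetDl setDDr setDv set0U; apply/eqP/idP => [<-|/setIidPr //].
  exact: subsetIl.
by move=> A sAS; rewrite setDDr setDv set0U; apply/setIidPr.
Qed.

(** Encoding the parity as a boolean treats [geven] and [godd] together and makes the parity of a
    product [b (+) c]. Zero has both parities. *)
Definition ghom b x : Prop := forall S, odd #|S| != b -> x S = 0.

Lemma gevenE x : geven x <-> ghom false x.
Proof. by split=> h S; [rewrite eqbF_neg negbK|move=> oS]; apply: h; rewrite ?oS. Qed.

Lemma goddE x : godd x <-> ghom true x.
Proof. by split=> h S; [rewrite eqb_id|move=> oS]; apply: h; rewrite ?eqb_id. Qed.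

Lemma ghom_swap b c x y : ghom b x -> ghom c y -> y * x = (-1) ^+ (b && c) *: (x * y).
Proof.
move=> hx hy; apply/ffunP => S; rewrite grassmann_swapE !ffunE /=.
rewrite [RHS]mulr_sumr; apply: eq_bigr => A _.
have [oA|/hx->] := eqVneq (odd #|A|) b; last by rewrite mulr0 mul0r !mulr0.
have [oB|/hy->] := eqVneq (odd #|S :\: A|) c; last by rewrite !mulr0.
by congr (_ * _); rewrite -oA -oB -oddM signr_odd.
Qed.

Lemma geven_comm x y : geven x -> GRing.comm x y.
Proof.
move=> hx; apply/ffunP => S; rewrite [RHS](grassmann_swapE x y) grassmannE.
apply: eq_bigr => A _; have [/hx->|eA] := boolP (odd #|A|).
  by rewrite mulr0 mul0r mulr0.
by rewrite -[(-1) ^+ (_ * _)]signr_odd oddM (negbTE eA) mul1r.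
Qed.

Lemma godd_anti x y : godd x -> godd y -> x * y = - (y * x).
Proof.
by move=> /goddE hx /goddE hy; rewrite (ghom_swap hx hy) expr1 scaleN1r opprK.
Qed.

(** Anticommuting with itself gives [2 x ^ 2 = 0], and 2 is cancellable in a [numFieldType]. *)
Lemma godd_sqr x : godd x -> x * x = 0.
Proof.
move=> hx; have /eqP := godd_anti hx hx; rewrite -addr_eq0 => /eqP/ffunP h.
apply/ffunP => S; have := h S; rewrite !ffunE => /eqP.
by rewrite -mulr2n mulrn_eq0 /= => /eqP.
Qed.

Lemma ghomD b x y : ghom b x -> ghom b y -> ghom b (x + y).
Proof. by move=> hx hy S oS; rewrite ffunE hx // hy // addr0. Qed.

Lemma ghomZ b (k : K) x : ghom b x -> ghom b (k *: x).
Proof. by move=> hx S oS; rewrite ffunE hx // scaler0. Qed.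

Lemma ghomM b c x y : ghom b x -> ghom c y -> ghom (b (+) c) (x * y).
Proof.
move=> hx hy S oS; rewrite grassmannE big1 // => A sAS.
have [oA|/hx->] := eqVneq (odd #|A|) b; last by rewrite mulr0 mul0r.
have [oB|/hy->] := eqVneq (odd #|S :\: A|) c; last by rewrite mulr0.
case/negP: oS; rewrite -oA -oB -(cardsID A S) (setIidPr sAS) oddD.
exact/eqP.
Qed.

Lemma ghom1 : ghom false 1.
Proof.
by move=> S oS; rewrite ffunE; case: (S =P set0) oS => [->|//]; rewrite cards0.
Qed.

Lemma ghom_sum b (I : Type) (r : seq I) (P : pred I) (F : I -> grassmann K n) :
  (forall i, P i -> ghom b (F i)) -> ghom b (\sum_(i <- r | P i) F i).
Proof.
move=> hF; apply: (big_ind (ghom b)) => //; last exact: ghomD.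
by move=> S _; rewrite ffunE.
Qed.

Lemma gbodyM x y : gbody (x * y) = gbody x * gbody y.
Proof.
rewrite /gbody grassmannE (bigD1 set0) //= big1 ?addr0 => [|A].
  by rewrite setD0 ninv0s expr0 mul1r.
by rewrite subset0 => /andP[->].
Qed.

Lemma gbodyD x y : gbody (x + y) = gbody x + gbody y.
Proof. by rewrite /gbody ffunE. Qed.

Lemma gbodyB x y : gbody (x - y) = gbody x - gbody y.
Proof. by rewrite /gbody !ffunE. Qed.

Lemma gbodyZ (k : K) x : gbody (k *: x) = k * gbody x.
Proof. by rewrite /gbody ffunE. Qed.

Lemma gbody1 : gbody (1 : grassmann K n) = 1.
Proof. by rewrite /gbody ffunE eqxx. Qed.

Lemma gbody_odd x : godd x -> gbody x = 0.
Proof. by apply; rewrite cards0. Qed.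

Lemma gbody_addoM x y t : godd y -> gbody (x + y * t) = gbody x.
Proof. by move=> oy; rewrite gbodyD gbodyM (gbody_odd oy) mul0r addr0. Qed.

Lemma gbodyX x k : gbody (x ^+ k) = gbody x ^+ k.
Proof. by elim: k => [|k IH]; rewrite ?gbody1 // !exprS gbodyM IH. Qed.

Lemma gbody_sum (I : Type) (r : seq I) (P : pred I) (F : I -> grassmann K n) :
  gbody (\sum_(i <- r | P i) F i) = \sum_(i <- r | P i) gbody (F i).
Proof.
by apply: (big_morph _ gbodyD); rewrite /gbody ffunE.
Qed.

(* In lowest degree the product is multiplication by the body. *)
Lemma mulg_reg x y : gbody y != 0 -> x * y = 0 -> x = 0.
Proof.
move=> y0 /ffunP xy0; apply/ffunP => S; rewrite [RHS]ffunE.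
have [k] := ubnP #|S|; elim: k S => // k IH S; rewrite ltnS => leSk.
have := xy0 S; rewrite grassmannE ffunE (bigD1 S) //= big1 ?addr0 => [|A].
  rewrite setDv ninvs0 expr0 mul1r => /eqP.
  by rewrite mulf_eq0 (negbTE y0) orbF => /eqP.
rewrite andbC -properEneq => /proper_card ltAS.
by rewrite IH ?mulr0 ?mul0r // (leq_trans ltAS).
Qed.

Definition gbasis A : grassmann K n := [ffun S => (S == A)%:R].

Lemma gbasis_sum x : x = \sum_A x A *: gbasis A.
Proof.
apply/ffunP => S; rewrite sum_ffunE (bigD1 S) //= big1 ?addr0 => [|A /negbTE nA].
  by rewrite !ffunE eqxx /GRing.scale /= mulr1.
by rewrite !ffunE eq_sym nA scaler0.
Qed.

Lemma mul_gbasisE x B S :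
  (x * gbasis B) S = if B \subset S then (-1) ^+ ninv (S :\: B) B * x (S :\: B) else 0.
Proof.
rewrite grassmannE; case: ifP => [sBS|nsBS].
  have eB : S :\: (S :\: B) = B by rewrite setDDr setDv set0U; apply/setIidPr.
  rewrite (bigD1 (S :\: B)) ?subsetDl //= big1 ?addr0 => [|A /andP[sAS nA]].
    by rewrite eB ffunE eqxx mulr1.
  rewrite ffunE; case: (S :\: A =P B) nA => [<-|]; last by rewrite mulr0.
  by rewrite setDDr setDv set0U (setIidPr sAS) eqxx.
apply: big1 => A _; rewrite ffunE.
case: (S :\: A =P B) nsBS => [<-|]; last by rewrite mulr0.
by rewrite subsetDl.
Qed.

End Grassmann.

Section Theta.
Variables (K : numFieldType) (n : nat).

Lemma theta_odd i : godd (theta K n i).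
Proof.
move=> S; rewrite ffunE; case: ltnP => //= ltin; case: eqP => // ->.
suff -> : [set j : 'I_n | val j == i] = [set Ordinal ltin] by rewrite cards1.
by apply/setP => j; rewrite !inE -val_eqE.
Qed.

Lemma thetaE (i : 'I_n) : theta K n i = gbasis K [set i].
Proof.
apply/ffunP => S; rewrite !ffunE ltn_ord; congr ((S == _)%:R).
by apply/setP => j; rewrite !inE.
Qed.

End Theta.

(** * Monomials in odd elements *)

(** Big products over ['I_n] run in increasing order; splitting at [i] locates the factors that
    [eta i] must cross. *)
Lemma index_enum_ord_split n (i : 'I_n) : exists r1 r2 : seq 'I_n,
  [/\ index_enum 'I_n = r1 ++ i :: r2, all (fun j : 'I_n => (j < i)%N) r1
    & all (fun j : 'I_n => (i < j)%N) r2].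
Proof.
have: pairwise (relpre val ltn) (index_enum 'I_n).
  rewrite -pairwise_map [index_enum _]unlock -enumT val_enum_ord -sorted_pairwise.
    exact: iota_ltn_sorted.
  exact: ltn_trans.
case/splitPr: (mem_index_enum i) => r1 r2.
rewrite pairwise_cat allrel_consr => /and3P[/andP[h1 _] _].
by rewrite pairwise_cons => /andP[h2 _]; exists r1, r2.
Qed.

Section Monomials.
Variables (K : numFieldType) (n m : nat) (eta : 'I_n -> grassmann K m).
Hypothesis eta_odd : forall i, godd (eta i).
Implicit Types (A B S : {set 'I_n}).

Definition gmono S := \prod_(i in S) eta i.

Lemma prod_odd_swap (r : seq 'I_n) (P : pred 'I_n) (x : grassmann K m) : godd x ->
  x * \prod_(i <- r | P i) eta i
    = (-1) ^+ count P r *: (\prod_(i <- r | P i) eta i * x).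
Proof.
move=> hx; elim: r => [|i r IH]; first by rewrite big_nil mulr1 mul1r scale1r.
rewrite big_cons /=; case: (P i) => /=; last by rewrite add0n.
rewrite mulrA (godd_anti hx (eta_odd i)) mulNr -!mulrA IH.
by rewrite -scalerAr exprD -scalerA expr1 scaleN1r.
Qed.

(** On its way to its place [eta i] crosses exactly the factors of smaller index, one sign each; the
    exponent is [ninv [set i] S]. *)
Lemma gmono_insert S i : i \notin S ->
  eta i * gmono S = (-1) ^+ (\sum_(j in S) (j < i)%N) *: gmono (i |: S).
Proof.
move=> niS; rewrite /gmono; have [r1 [r2 [-> h1 h2]]] := index_enum_ord_split i.
rewrite !big_cat !big_cons /= (negbTE niS) in_setU1 eqxx /=.
rewrite [X in (_ + X)%N]big1_seq ?addn0 => [|j /andP[_ /(allP h2)]]; last first.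
  by case: ltngtP.
have -> : (\sum_(j <- r1 | j \in S) (j < i) = count (mem S) r1)%N.
  rewrite -sum1_count big_seq_cond [RHS]big_seq_cond.
  by apply: eq_bigr => j /andP[/(allP h1) -> _].
have eqS (r : seq 'I_n) : i \notin r ->
    \prod_(j <- r | j \in i |: S) eta j = \prod_(j <- r | j \in S) eta j.
  move=> nir; rewrite big_seq_cond [RHS]big_seq_cond.
  apply: eq_bigl => j; rewrite in_setU1; case: eqP => // ->.
  by rewrite (negbTE nir).
rewrite !eqS; first by rewrite mulrA (prod_odd_swap r1 _ (eta_odd i)) -scalerAl mulrA.
  by apply/negP => /(allP h2); rewrite ltnn.
by apply/negP => /(allP h1); rewrite ltnn.
Qed.

(** Moved up to its second occurrence, [eta i] produces the square of an odd element. *)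
Lemma gmono_repeat S i : i \in S -> eta i * gmono S = 0.
Proof.
move=> iS; rewrite /gmono; have [r1 [r2 [-> h1 h2]]] := index_enum_ord_split i.
rewrite !big_cat !big_cons /= iS mulrA (prod_odd_swap r1 _ (eta_odd i)) -scalerAl -mulrA.
by rewrite [eta i * (eta i * _)]mulrA godd_sqr // mul0r mulr0 scaler0.
Qed.

Lemma gmono_max A i : i \in A -> (forall j, j \in A -> (j <= i)%N) ->
  gmono A = gmono (A :\ i) * eta i.
Proof.
move=> iA Ai; rewrite /gmono; have [r1 [r2 [-> h1 h2]]] := index_enum_ord_split i.
rewrite !big_cat !big_cons /= iA in_setD1 eqxx /=.
rewrite !(@big1_seq _ _ _ _ r2); first last.
- by move=> j /andP[/Ai le_ji /(allP h2)]; rewrite ltnNge le_ji.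
- move=> j /andP[/setD1P[_ /Ai le_ji] /(allP h2)].
  by rewrite ltnNge le_ji.
rewrite !mulr1; congr (_ * _); rewrite big_seq_cond [RHS]big_seq_cond.
apply: eq_bigl => j; rewrite in_setD1.
by case: (boolP (j \in r1)) => //= /(allP h1); case: eqP => // ->; rewrite ltnn.
Qed.

(** Monomials in arbitrary odd elements obey the sign rule of the basis [e_S]. Induction on [#|A|]:
    the largest index of [A] is the rightmost factor, and it is inserted into [B] first. *)
Lemma gmonoM A B : gmono A * gmono B =
  if [disjoint A & B] then (-1) ^+ ninv A B *: gmono (A :|: B) else 0.
Proof.
have [k] := ubnP #|A|; elim: k A B => // k IH A B; rewrite ltnS => leAk.
have [->|[i0 i0A]] := set_0Vmem A.
  by rewrite /gmono big_set0 mul1r ninv0s scale1r set0U -setI_eq0 set0I eqxx.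
have [i iA Ai] := arg_maxnP (fun j : 'I_n => nat_of_ord j) i0A.
change (is_true (i \in A)) in iA.
have {}Ai j : j \in A -> (j <= i)%N by apply: Ai.
have ltAk : (#|A :\ i| < k)%N by rewrite (cardsD1 i A) iA in leAk.
rewrite (gmono_max iA Ai) -mulrA.
have [iB|niB] := boolP (i \in B).
  rewrite gmono_repeat // mulr0; case: ifP => // dAB.
  by rewrite (disjointFr dAB iA) in iB.
rewrite gmono_insert // -scalerAr IH //.
have eD : [disjoint A :\ i & i |: B] = [disjoint A & B].
  rewrite -!setI_eq0; apply/eqP/eqP => /setP e; apply/setP => j.
    have := e j; rewrite !inE; case: eqP => // -> _.
    by rewrite (negbTE niB) andbF.
  by have := e j; rewrite !inE; case: eqP.
rewrite eD; case: ifP => dAB; last by rewrite scaler0.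
rewrite scalerA -exprD; congr ((-1) ^+ _ *: gmono _); last first.
  by apply/setP => j; rewrite !inE; case: eqP => // ->; rewrite iA.
rewrite -{2}(setD1K iA) ninvUl; last by rewrite disjoints1 !inE eqxx.
rewrite ninvUr; last by rewrite disjoints1.
rewrite {1 3}/ninv big_set1; congr (_ + _)%N.
rewrite -[RHS]add0n; congr (_ + _)%N; rewrite /ninv.
apply: big1 => j /setD1P[nji /Ai le_ji]; rewrite big_set1.
by rewrite ltnNge le_ji.
Qed.

Lemma ghom_gmono S : ghom (odd #|S|) (gmono S).
Proof.
rewrite /gmono -sum1_card; apply: (big_rec2 (fun x y => ghom (odd y) x)).
  exact: ghom1.
by move=> i k x _ hx; rewrite oddD; apply: ghomM hx; apply/goddE.
Qed.

End Monomials.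

(** * Substitutions of odd elements *)

Section SubstLinear.
Variables (K : numFieldType) (n m : nat) (eta : 'I_n -> grassmann K m).
Implicit Types x y : grassmann K n.

Lemma gsubst_is_linear : linear (gsubst eta).
Proof.
move=> k x y; rewrite /gsubst scaler_sumr -big_split; apply: eq_bigr => S _ /=.
by rewrite !ffunE scalerDl scalerA.
Qed.

HB.instance Definition _ :=
  GRing.isLinear.Build K (grassmann K n) (grassmann K m) _ (gsubst eta) gsubst_is_linear.

Lemma gsubst_gbasis S : gsubst eta (gbasis K S) = gmono eta S.
Proof.
rewrite /gsubst (bigD1 S) //= [X in _ + X]big1 ?addr0 => [|A /negbTE nA].
  by rewrite ffunE eqxx scale1r.
by rewrite ffunE nA scale0r.
Qed.

Lemma gsubst1 : gsubst eta 1 = 1.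
Proof.
have -> : 1 = gbasis K (set0 : {set 'I_n}) by apply/ffunP => S; rewrite !ffunE.
by rewrite gsubst_gbasis /gmono big_set0.
Qed.

Lemma gsubst_theta (i : 'I_n) : gsubst eta (theta K n i) = eta i.
Proof. by rewrite thetaE gsubst_gbasis /gmono big_set1. Qed.

End SubstLinear.

Lemma eq_gsubst (K : numFieldType) n m (eta eta' : 'I_n -> grassmann K m) :
  eta =1 eta' -> gsubst eta =1 gsubst eta'.
Proof.
by move=> e x; apply: eq_bigr => S _; congr (_ *: _); apply: eq_bigr => i _.
Qed.

Section Subst.
Variables (K : numFieldType) (n m : nat) (eta : 'I_n -> grassmann K m).
Hypothesis eta_odd : forall i, godd (eta i).
Implicit Types x y : grassmann K n.

(** Both sides expand over pairs of index sets, with equal signs by [gmonoM]; overlapping pairs,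
    absent on the left, contribute zero on the right. *)
Lemma gsubstM x y : gsubst eta (x * y) = gsubst eta x * gsubst eta y.
Proof.
rewrite {2 3}/gsubst mulr_suml.
transitivity (\sum_(S : {set 'I_n}) \sum_(A : {set 'I_n} | A \subset S)
    (x A * y (S :\: A)) *: (gmono eta A * gmono eta (S :\: A))).
  apply: eq_bigr => S _; rewrite grassmannE scaler_suml.
  apply: eq_bigr => A sAS; rewrite gmonoM //.
  rewrite -setI_eq0 setIDA setIC setDIl setDv setI0 eqxx.
  rewrite setDE setUIr setUCr setIT (setUidPr sAS) scalerA /gmono.
  by congr (_ *: _); rewrite -mulrA mulrC.
rewrite (exchange_big_dep predT) //=; apply: eq_bigr => A _.
rewrite mulr_sumr [RHS](bigID (fun B : {set _}  => [disjoint A & B])) /=.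
rewrite [X in _ = _ + X]big1 ?addr0 => [|B /negbTE ndAB]; last first.
  by rewrite -scalerAl -scalerAr -!/(gmono _ _) gmonoM // ndAB !scaler0.
(* A set [B] disjoint from [A] corresponds to the set [S = A :|: B] containing [A]. *)
rewrite (reindex_onto (fun B => A :|: B) (fun S => S :\: A)) /= => [|S sAS].
  apply: eq_big => [B|B /andP[_ /eqP ->]].
    rewrite subsetUl /= setDUl setDv set0U disjoint_sym.
    by apply/eqP/idP => [/setDidPl|/setDidPl].
  by rewrite -scalerA -scalerAl -scalerAr.
by rewrite setUC setDE setUIl setUC (setUC _ A) setUCr setIT (setUidPr sAS).
Qed.

Lemma ghom_gsubst b x : ghom b x -> ghom b (gsubst eta x).
Proof.
move=> hx; apply: ghom_sum => S _.
have [<-|/hx->] := eqVneq (odd #|S|) b; last by move=> A _; rewrite scale0r ffunE.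
exact/ghomZ/ghom_gmono.
Qed.

Lemma gbody_gsubst x : gbody (gsubst eta x) = gbody x.
Proof.
rewrite gbody_sum (bigD1 set0) //= [X in _ + X]big1 ?addr0 => [|S /set0Pn[i iS]].
  by rewrite gbodyZ big_set0 gbody1 mulr1.
rewrite gbodyZ (big_morph _ (@gbodyM K m) (@gbody1 K m)) (bigD1 i) //=.
by rewrite (gbody_odd (eta_odd i)) mul0r mulr0.
Qed.

Lemma gsubst_comp l (eta' : 'I_l -> grassmann K n) (z : grassmann K l) :
  gsubst eta (gsubst eta' z) = gsubst (fun i => gsubst eta (eta' i)) z.
Proof.
rewrite linear_sum; apply: eq_bigr => S _; rewrite linearZ; congr (_ *: _).
exact: (big_morph _ gsubstM (gsubst1 eta)).
Qed.

End Subst.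

(** Splitting off the largest generator on the right creates no inversion, hence no sign. *)
Lemma gmono_theta (K : numFieldType) n (S : {set 'I_n}) :
  gmono (fun i : 'I_n => theta K n i) S = gbasis K S.
Proof.
have [k] := ubnP #|S|; elim: k S => // k IH S; rewrite ltnS => leSk.
have [->|[i0 i0S]] := set_0Vmem S.
  by rewrite /gmono big_set0; apply/ffunP => A; rewrite !ffunE.
have [i iS Si] := arg_maxnP (fun j : 'I_n => nat_of_ord j) i0S.
change (is_true (i \in S)) in iS.
have {}Si j : j \in S -> (j <= i)%N by apply: Si.
have ltSk : (#|S :\ i| < k)%N by rewrite (cardsD1 i S) iS in leSk.
rewrite (gmono_max _ iS Si) IH // thetaE; apply/ffunP => A.
rewrite mul_gbasisE !ffunE sub1set; case: ifP => [iA|niA]; last first.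
  by case: eqP niA => // ->; rewrite iS.
have -> : (A :\ i == S :\ i) = (A == S).
  by apply/eqP/eqP => [e|-> //]; rewrite -(setD1K iA) e setD1K.
case: eqP => [->|_]; last by rewrite mulr0.
rewrite /ninv big1 ?mulr1 // => j /setD1P[_ /Si le_ji].
by rewrite big_set1 ltnNge le_ji.
Qed.

(** * Inclusions of Grassmann algebras *)

Section Inclusion.
Variables (K : numFieldType).

Lemma gsubst_id n (x : grassmann K n) : gsubst (fun i : 'I_n => theta K n i) x = x.
Proof.
rewrite [RHS]gbasis_sum; apply: eq_bigr => S _.
by rewrite -/(gmono (fun i : 'I_n => theta K n i) S) gmono_theta.
Qed.

Variables (n m : nat).
Implicit Types x y : grassmann K n.

HB.instance Definition _ := GRing.Linear.copy (@ginc K n m)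
  (gsubst (fun i : 'I_n => theta K m i)).

Lemma ginc1 : ginc m (1 : grassmann K n) = 1. Proof. exact: gsubst1. Qed.

Lemma ginc0 : ginc m (0 : grassmann K n) = 0. Proof. exact: linear0. Qed.

Lemma gincD x y : ginc m (x + y) = ginc m x + ginc m y.
Proof. exact: linearD. Qed.

Lemma gincN x : ginc m (- x) = - ginc m x. Proof. exact: linearN. Qed.

Lemma gincB x y : ginc m (x - y) = ginc m x - ginc m y.
Proof. exact: linearB. Qed.

Lemma gincM x y : ginc m (x * y) = ginc m x * ginc m y.
Proof. by apply: gsubstM => i; apply: theta_odd. Qed.

Lemma ghom_ginc b x : ghom b x -> ghom b (ginc m x).
Proof. by apply: ghom_gsubst => i; apply: theta_odd. Qed.

Lemma gbody_ginc x : gbody (ginc m x) = gbody x.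
Proof. by apply: gbody_gsubst => i; apply: theta_odd. Qed.

Lemma ginc_theta i : (i < n)%N -> ginc m (theta K n i) = theta K m i.
Proof. by move=> lti; rewrite /ginc (gsubst_theta _ (Ordinal lti)). Qed.

End Inclusion.

(** * Specialization of the odd coordinate, carried by the last generator *)

Section LastVariable.
Variables (K : numFieldType) (N : nat).

(** This is the substitution inside [seval], so that [seval] and [geval (last_subst xi)] are
    convertible. *)
Definition last_subst m (xi : grassmann K m) (i : 'I_N.+1) :=
  if (i < N)%N then theta K m i else xi.

Definition set_last m (xi : grassmann K m) := gsubst (last_subst xi).

HB.instance Definition _ m (xi : grassmann K m) :=
  GRing.Linear.copy (@set_last m xi) (gsubst (last_subst xi)).

(** Restriction to the locus where the odd coordinate vanishes; the result lives over the
    coefficient algebra. *)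
Definition forget_last := set_last (0 : grassmann K N).

HB.instance Definition _ := GRing.Linear.copy forget_last (set_last (0 : grassmann K N)).

Section SetLast.
Variables (m : nat) (xi : grassmann K m).
Hypothesis xi_odd : godd xi.
Implicit Types (x y : grassmann K N.+1).

Lemma last_subst_odd i : godd (last_subst xi i).
Proof. by rewrite /last_subst; case: ifP => // _; apply: theta_odd. Qed.

Lemma set_lastD x y : set_last xi (x + y) = set_last xi x + set_last xi y.
Proof. exact: linearD. Qed.

Lemma set_lastM x y : set_last xi (x * y) = set_last xi x * set_last xi y.
Proof. exact/gsubstM/last_subst_odd. Qed.

Lemma gbody_set_last x : gbody (set_last xi x) = gbody x.
Proof. exact/gbody_gsubst/last_subst_odd. Qed.

Lemma set_last_ginc (x : grassmann K N) : set_last xi (ginc N.+1 x) = ginc m x.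
Proof.
rewrite /set_last gsubst_comp; last exact: last_subst_odd.
apply: eq_gsubst => i.
rewrite (gsubst_theta _ (widen_ord (leqnSn N) i)) /last_subst /=.
by rewrite ltn_ord.
Qed.

Lemma set_last_theta : set_last xi (theta K N.+1 N) = xi.
Proof.
by rewrite /set_last (gsubst_theta _ (ord_max : 'I_N.+1)) /last_subst /= ltnn.
Qed.

End SetLast.

Lemma godd0 m : godd (0 : grassmann K m).
Proof. by move=> S _; rewrite ffunE. Qed.

Lemma ginc_forget_last m (x : grassmann K N.+1) :
  ginc m (forget_last x) = set_last (0 : grassmann K m) x.
Proof.
rewrite /ginc gsubst_comp => [|i]; last exact: theta_odd.
apply: eq_gsubst => i; rewrite /last_subst; case: ifP => lti; last exact: linear0.
by rewrite -/(ginc _ _) ginc_theta.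
Qed.

(* Terms of [x] containing the last generator are killed since [xi ^ 2 = 0]. *)
Lemma set_last_mulr m (xi : grassmann K m) x : godd xi ->
  set_last xi x * xi = ginc m (forget_last x) * xi.
Proof.
move=> hxi; rewrite ginc_forget_last /set_last /gsubst !mulr_suml.
apply: eq_bigr => S _; rewrite -!scalerAl; congr (_ *: _).
have [maxS|nmaxS] := boolP ((ord_max : 'I_N.+1) \in S); last first.
  congr (_ * _); apply: eq_bigr => i iS; rewrite /last_subst; case: ifP => //.
  move=> /negbT; rewrite -leqNgt => leNi; case/negP: nmaxS.
  suff <- : i = ord_max by [].
  by apply: val_inj; apply/eqP; rewrite /= eqn_leq leNi -ltnS ltn_ord.
rewrite -!/(gmono _ _) !(@gmono_max _ _ _ _ S ord_max) //; first last.
- by move=> j _; rewrite -ltnS ltn_ord.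
- by move=> j _; rewrite -ltnS ltn_ord.
by rewrite /last_subst ltnn -mulrA godd_sqr // !mulr0 mul0r.
Qed.

Lemma forget_last_ginc (x : grassmann K N) : forget_last (ginc N.+1 x) = x.
Proof.
rewrite /forget_last set_last_ginc; first exact: gsubst_id.
exact: godd0.
Qed.

(** A generator that does not occur in an element can be cancelled. *)
Lemma ginc_mul_theta_eq0 (x : grassmann K N) :
  ginc N.+1 x * theta K N.+1 N = 0 -> x = 0.
Proof.
(* It suffices that any [y] killed by the last generator has [forget_last y = 0]. *)
move=> h; rewrite -(forget_last_ginc x); move: h; move: (ginc _ x) => y.
rewrite (thetaE K (ord_max : 'I_N.+1)) => /ffunP y0.
rewrite /forget_last /set_last /gsubst big1 // => S _.
have [maxS|nmaxS] := boolP ((ord_max : 'I_N.+1) \in S).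
  rewrite -/(gmono _ S) (gmono_max _ maxS); last first.
    by move=> j _; rewrite -ltnS ltn_ord.
  by rewrite /last_subst ltnn mulr0 scaler0.
(* Up to sign, this coefficient of the product is the coefficient of [y] at [S]. *)
have := y0 (ord_max |: S); rewrite mul_gbasisE sub1set setU11 setU1K // ffunE.
by move/eqP; rewrite mulf_eq0 signr_eq0 => /eqP ->; rewrite scale0r.
Qed.

End LastVariable.

Lemma ginc_comp (K : numFieldType) n l m (x : grassmann K n) : (n <= l)%N ->
  ginc m (ginc l x) = ginc m x.
Proof.
move=> lenl; rewrite /ginc gsubst_comp => [|i]; last exact: theta_odd.
apply: eq_gsubst => i; rewrite -/(ginc _ _) ginc_theta //.
exact: leq_trans (ltn_ord i) lenl.
Qed.

(** * Derivatives and Taylor expansions *)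

From mathcomp Require Import all_classical all_reals.
From mathcomp Require Import topology normedtype derive.
Import numFieldNormedType.Exports.
Local Open Scope classical_set_scope.
Local Open Scope ring_scope.

Section GrassmannDerivative.
Variables (R : realType) (n : nat).
Implicit Types (F G : Cplx R -> Lambda R n) (z : Cplx R).

Definition is_gderiv z F (dF : Lambda R n) : Prop :=
  forall S, is_derive z 1 (fun u : Cplx R => F u S) (dF S).

Lemma gderiv1E F z S : gderiv 1 F z S = 'D_1 (fun u : Cplx R => F u S) z.
Proof. by rewrite ffunE -derive1E. Qed.

Lemma is_gderivE z F dF : is_gderiv z F dF -> gderiv 1 F z = dF.
Proof.
by move=> h; apply: grassmannP => S; have [_ <-] := h S; rewrite gderiv1E.
Qed.

Lemma holomorphic_is_gderiv D F z :
  holomorphic_on D F -> D z -> is_gderiv z F (gderiv 1 F z).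
Proof.
move=> hF Dz S; rewrite gderiv1E; apply/derivableP.
exact: hF.
Qed.

Lemma eq_gderiv (D : set (Cplx R)) F G z : open D -> D z ->
  (forall u, D u -> F u = G u) -> gderiv 1 F z = gderiv 1 G z.
Proof.
move=> oD Dz eFG; apply: grassmannP => S; rewrite [LHS]gderiv1E [RHS]gderiv1E.
apply: near_eq_derive; near=> u; rewrite (eFG u) //.
by near: u; apply: open_nbhs_nbhs.
Unshelve. all: by end_near. Qed.

(** Coefficients of the wrong parity vanish on a whole neighbourhood of [z], so their derivatives
    vanish too. *)
Lemma ghom_gderiv (D : set (Cplx R)) b F z : open D -> D z ->
  (forall u, D u -> ghom b (F u)) -> ghom b (gderiv 1 F z).
Proof.
move=> oD Dz hF S oS; rewrite gderiv1E.
rewrite -[RHS](derive_cst (0 : Cplx R) z 1).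
apply: near_eq_derive; near=> u; rewrite /cst; apply: hF => //.
by near: u; apply: open_nbhs_nbhs.
Unshelve. all: by end_near. Qed.

Lemma gderiv0 F z : gderiv 0 F z = F z.
Proof. by apply: grassmannP => S; rewrite ffunE. Qed.

Lemma is_derive_bigsum (I : Type) (r : seq I) (P : pred I)
    (h : I -> Cplx R -> Cplx R) (dh : I -> Cplx R) z :
  (forall i, P i -> is_derive z 1 (h i) (dh i)) ->
  is_derive z 1 (fun u => \sum_(i <- r | P i) h i u) (\sum_(i <- r | P i) dh i).
Proof.
move=> hh; rewrite -fct_sumE; apply: (big_rec2 (fun f d => is_derive z 1 f d)).
  exact: is_derive_cst.
by move=> i d f Pi hf; exact: (is_deriveD (hh i Pi) hf).
Qed.

(** Each coefficient of a product is bilinear with constant signs. The differentiation variable is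
    even, so the Leibniz rule acquires no sign, but the order of the factors is kept. *)
Lemma is_gderivM z F G dF dG : is_gderiv z F dF -> is_gderiv z G dG ->
  is_gderiv z (fun u => F u * G u) (dF * G z + F z * dG).
Proof.
move=> hF hG S; rewrite gcoefD !grassmannE -big_split.
rewrite (_ : (fun u => _) = fun u => \sum_(A : {set 'I_n} | A \subset S)
    (-1) ^+ ninv A (S :\: A) * F u A * G u (S :\: A)); last first.
  by apply/funext => u; rewrite grassmannE.
apply: is_derive_bigsum => A _; set s := (-1) ^+ _.
have h := is_deriveM (is_deriveZ s (hF A)) (hG (S :\: A)).
apply: is_derive_eq h _; rewrite addrC.
by apply: (congr2 +%R); first exact: mulrC.
Qed.

End GrassmannDerivative.

Lemma is_gderiv_linear (R : realType) n m (L : {linear Lambda R n -> Lambda R m})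
    z F (dF : Lambda R n) :
  is_gderiv z F dF -> is_gderiv z (fun u => L (F u)) (L dF).
Proof.
move=> hF S.
have LE (x : Lambda R n) : L x S = \sum_A L (gbasis (Cplx R) A) S * x A.
  rewrite {1}(gbasis_sum x) linear_sum gcoef_sum; apply: eq_bigr => A _.
  by rewrite linearZ gcoefZ mulrC.
rewrite LE (_ : (fun u => _) = fun u => \sum_A L (gbasis (Cplx R) A) S * F u A).
  by apply: is_derive_bigsum => A _; apply: is_deriveZ (hF A).
by apply/funext => u; rewrite LE.
Qed.

Lemma big_ord_recl2 (V : nmodType) m (h : nat -> V) : (0 < m)%N ->
  \sum_(k < m.+1) h k = h 0 + h 1%N + \sum_(k < m.-1) h k.+2.
Proof. by case: m => // m _; rewrite !big_ord_recl addrA. Qed.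

(** * Taylor evaluation at even elements *)

Section Evaluation.
Variables (R : realType) (n m : nat) (eta : 'I_n -> Lambda R m).
Implicit Types (F : Cplx R -> Lambda R n) (z : Cplx R) (d : Lambda R m).

Lemma gbody_scalar z : gbody (z%:A : Lambda R m) = z.
Proof. by rewrite gbodyZ gbody1 mulr1. Qed.

Lemma gevalE F w (d := w - (gbody w)%:A) : (0 < m)%N ->
  geval eta F w = gsubst eta (F (gbody w)) + gsubst eta (gderiv 1 F (gbody w)) * d
    + \sum_(k < m.-1)
        (k.+2`!%:R)^-1 *: (gsubst eta (gderiv k.+2 F (gbody w)) * d ^+ k.+2).
Proof.
move=> m_gt0; rewrite /geval.
rewrite (big_ord_recl2 (fun k => (k`!%:R)^-1 *:
  (gsubst eta (gderiv k F (gbody w)) * (w - (gbody w)%:A) ^+ k)) m_gt0).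
have c1 : (1%N%:R : Cplx R)^-1 = 1 by rewrite invr1.
rewrite -/d; congr (_ + _ + _).
  by rewrite fact0 c1 scale1r expr0 mulr1 gderiv0.
by rewrite c1 scale1r.
Qed.

Lemma geval_square0 F z d : (0 < m)%N -> gbody d = 0 -> d * d = 0 ->
  geval eta F (z%:A + d) = gsubst eta (F z) + gsubst eta (gderiv 1 F z) * d.
Proof.
move=> m_gt0 d0 dd0; rewrite gevalE // gbodyD gbody_scalar d0 addr0.
rewrite [_ + d]addrC addrK big1 ?addr0 // => k _.
by rewrite !exprS [d * (d * _)]mulrA dd0 mul0r mulr0 scaler0.
Qed.

(** A Hadamard-type factorization: the nilpotent parts [x] and [y] commute, so [x - y] divides each
    difference of powers in the Taylor sums. The body of the cofactor comes from the first
    derivative alone. *)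
Lemma geval_sub F w1 w2 : (0 < m)%N -> (forall i, godd (eta i)) ->
  geven w1 -> geven w2 -> gbody w1 = gbody w2 ->
  exists U, geval eta F w1 - geval eta F w2 = U * (w1 - w2) /\
    gbody U = gbody (gderiv 1 F (gbody w1)).
Proof.
move=> m_gt0 eta_odd ev1 ev2 eb; 
set z := gbody w1; set x := w1 - z%:A; set y := w2 - z%:A.
have bx : gbody x = 0 by rewrite gbodyB gbody_scalar subrr.
have by0 : gbody y = 0 by rewrite gbodyB gbody_scalar -eb subrr.
have exy : w1 - w2 = x - y by rewrite opprB addrA subrK.
have cw : GRing.comm (w1 - w2) y.
  by apply/commr_sym/commrB; apply/commr_sym; apply: geven_comm.
have cw' u : GRing.comm (w1 - w2) u.
  by apply/commr_sym/commrB; apply/commr_sym; apply: geven_comm.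
have cxy : GRing.comm x y.
  by rewrite -(subrK y x) -exy; apply/commr_sym/commrD => //; apply/commr_sym.
exists (gsubst eta (gderiv 1 F z) +
  \sum_(k < m.-1) (k.+2`!%:R)^-1 *: (gsubst eta (gderiv k.+2 F z) *
    \sum_(i < k.+2) x ^+ (k.+1 - i) * y ^+ i)); split.
  rewrite !gevalE // -eb -/z -/x -/y opprD addrACA mulrDl; congr (_ + _).
    by rewrite opprD addrACA subrr add0r -mulrBr exy.
  rewrite mulr_suml -sumrB.
  apply: eq_bigr => k _.
  rewrite -scalerBr -mulrBr subrXX_comm // -exy -scalerAl -mulrA.
  by rewrite [in LHS]cw'.
rewrite gbodyD gbody_gsubst // gbody_sum big1 ?addr0 // => k _.
rewrite gbodyZ gbodyM [gbody (\sum_(i < _) _)]gbody_sum.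
rewrite [X in _ * (_ * X)]big1 ?mulr0 // => i _.
(* Each summand has total degree [k.+1 > 0] in elements of zero body. *)
by rewrite gbodyM !gbodyX bx by0 -exprD subnK -1?ltnS // expr0n.
Qed.

Lemma gbody_geval F w : (0 < m)%N -> (forall i, godd (eta i)) ->
  gbody (geval eta F w) = gbody (F (gbody w)).
Proof.
move=> m_gt0 eta_odd; rewrite gevalE //; set d := w - _.
have d0 : gbody d = 0 by rewrite gbodyB gbody_scalar subrr.
rewrite !gbodyD gbodyM d0 mulr0 addr0 gbody_gsubst //.
rewrite [gbody (\sum_(k < _) _)]gbody_sum big1 ?addr0 // => k _.
by rewrite gbodyZ gbodyM gbodyX d0 expr0n !mulr0.
Qed.

End Evaluation.

Lemma gext_square0 (R : realType) n m (F : Cplx R -> Lambda R n) z (d : Lambda R m) :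
  (0 < m)%N -> gbody d = 0 -> d * d = 0 ->
  gext F (z%:A + d) = ginc m (F z) + ginc m (gderiv 1 F z) * d.
Proof. exact: geval_square0. Qed.

(** * First-order expansion along a divisor *)

Section FirstOrder.
Variables (R : realType) (N m : nat).

Lemma oddM_sqr0 (x y : Lambda R m) : godd x -> godd y -> x * y * (x * y) = 0.
Proof.
move=> hx hy; rewrite -mulrA [y * _]mulrA (godd_anti hy hx) mulNr mulrN.
by rewrite -[x * y * y]mulrA godd_sqr // mulr0 mulr0 oppr0.
Qed.

Lemma sevalE (F : Cplx R -> Lambda R N.+1) (w xi : Lambda R m) :
  seval F w xi = geval (last_subst xi) F w.
Proof. by []. Qed.

Lemma set_lastE (xi : Lambda R m) (x : Lambda R N.+1) :
  gsubst (last_subst xi) x = set_last xi x.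
Proof. by []. Qed.

Lemma gbody_seval (F : Cplx R -> Lambda R N.+1) (w xi : Lambda R m) :
  (0 < m)%N -> godd xi -> gbody (seval F w xi) = gbody (F (gbody w)).
Proof. by move=> m_gt0 xi_odd; apply/gbody_geval/last_subst_odd. Qed.

Lemma gderiv_forget_last (D : set (Cplx R)) (F : Cplx R -> Lambda R N.+1)
    (F0 : Cplx R -> Lambda R N) z :
  open D -> holomorphic_on D F -> D z ->
  (forall u, D u -> forget_last (F u) = F0 u) ->
  forget_last (gderiv 1 F z) = gderiv 1 F0 z.
Proof.
move=> oD hF Dz eF; rewrite -(eq_gderiv oD Dz eF); apply/esym/is_gderivE.
exact/is_gderiv_linear/(holomorphic_is_gderiv hF).
Qed.

(* At the point [(z + e xi, xi)] second derivatives are killed by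
  [(e xi) ^ 2 = 0], and the first derivative only enters through its part that
  does not contain the odd variable. *)
Lemma seval_first_order (D : set (Cplx R)) (F : Cplx R -> Lambda R N.+1)
    (F0 : Cplx R -> Lambda R N) z (e xi : Lambda R m) :
  (0 < m)%N -> open D -> holomorphic_on D F -> D z ->
  (forall u, D u -> forget_last (F u) = F0 u) -> godd e -> godd xi ->
  seval F (z%:A + e * xi) xi
    = set_last xi (F z) + ginc m (gderiv 1 F0 z) * (e * xi).
Proof.
move=> m_gt0 oD hF Dz eF he hxi.
have d0 : gbody (e * xi) = 0 by rewrite gbodyM (gbody_odd he) mul0r.
rewrite -(gderiv_forget_last oD hF Dz eF) sevalE.
rewrite (geval_square0 _ _ _ m_gt0 d0 (oddM_sqr0 he hxi)) -!set_lastE.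
(* Writing [e * xi] as [- (xi * e)] puts [xi] next to the derivative, where [set_last_mulr]
   applies. *)
rewrite (godd_anti he hxi) !mulrN; congr (_ - _).
rewrite [LHS]mulrA [RHS]mulrA; congr (_ * _).
by rewrite (set_last_mulr _ hxi).
Qed.

End FirstOrder.

Lemma overlap_open (R : realType) (X : topologicalType) (V : Type)
  (A : bodyAtlas R X V) v' v : open (overlap A v' v).
Proof.
apply: chart_coord_open; first exact: subIsetl.
by apply: openI; apply: chart_dom_open.
Qed.

(** * The identity behind the dual coordinates *)

(** The divisor equation in the chart [v'] after removing [f(a)] and the factors [f'] and [g]: [t]
    is zeta, [x] is xi, [a] and [b] are alpha and beta, [b1] is the derivative of beta, and [q] is
    [(g beta)' / g]. *)
Lemma dual_identity_normalized (A : pzRingType) (a b b1 q t x : A) :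
  t * t = 0 -> q * t = - (t * q) -> q * a = - (a * q) -> a * x = - (x * a) ->
  q * a * t * b = b1 * a * t * b ->
  x * a + t * x
    = (- ((1 - b1 * a) * t * b) + a * b)
      + ((1 - q * a) * t - a) * (x + b + q * (t * x)).
Proof.
move=> tt qt qa ax qb.
have tqt y : t * (q * (t * y)) = 0.
  by rewrite !mulrA -[t * q]opprK -qt mulNr -[q * t * t]mulrA tt mulr0 oppr0 mul0r.
(* The surviving term cancels its opposite in [e2]; [e3] cancels the shift of the even
   coordinate. *)
have e1 : ((1 - q * a) * t - a) * (q * (t * x)) = q * a * (t * x).
  by rewrite mulrBl -[_ * t * _]mulrA tqt mulr0 sub0r [a * _]mulrA -mulNr -qa.
have e2 : ((1 - q * a) * t - a) * x = t * x - q * a * (t * x) + x * a.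
  by rewrite mulrBl ax opprK -[_ * t * x]mulrA mulrBl mul1r.
have e3 : ((1 - q * a) * t - a) * b = (1 - b1 * a) * t * b - a * b.
  by rewrite mulrBl !mulrBl !mul1r qb.
rewrite mulrDr mulrDr e1 e2 e3; set w := _ - a * b.
have -> : - ((1 - b1 * a) * t * b) + a * b = - w by rewrite opprB addrC.
rewrite -[X in - w + X]addrA [w + _]addrC [X in - w + X]addrA.
by rewrite [_ - _ + x * a]addrAC subrK [RHS]addrC addrK addrC.
Qed.

(** With [F1] factored out and [Gi * G = 1], only the normalized identity remains. *)
Lemma dual_identity (K : numFieldType) m
    (F1 Gi G d a b b1 G1 t x : grassmann K m) :
  geven F1 -> (forall y, GRing.comm Gi y) -> Gi * G = 1 ->
  geven G1 -> godd a -> godd b -> godd b1 -> godd t -> godd x ->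
  d = G1 * b + G * b1 ->
  F1 * (x * a) + F1 * (t * x)
    = F1 * (- ((1 - b1 * a) * t * b) + a * b)
      + Gi * F1 * ((1 - Gi * d * a) * t - a) * (G * (x + b) + d * (t * x)).
Proof.
move=> eF1 cGi GiG eG1 oa ob ob1 ot ox ed; set q := Gi * d.
(* Here [q = Gi * G1 * b + b1], a sum of central multiples of odd elements. *)
have Gd y : godd y -> q * y = - (y * q).
  move=> oy; rewrite /q ed mulrDr !mulrA GiG mul1r mulrDl mulrDr opprD.
  rewrite (godd_anti ob1 oy) -mulrA (godd_anti ob oy) mulrN; congr (- _ - _).
  by rewrite !mulrA -[Gi * G1 * y]mulrA (geven_comm y eG1) mulrA cGi.
have -> : Gi * F1 * ((1 - q * a) * t - a) * (G * (x + b) + d * (t * x))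
    = F1 * (((1 - q * a) * t - a) * (x + b + q * (t * x))).
  rewrite cGi -!mulrA; congr (F1 * _); rewrite mulrA cGi -mulrA; congr (_ * _).
  by rewrite mulrDr !mulrA GiG mul1r.
rewrite -!mulrDr; congr (F1 * _); apply: dual_identity_normalized.
- exact: godd_sqr.
- exact: Gd.
- exact: Gd.
- exact: godd_anti.
(* The part of [q] that contains [b] drops out: [a * t] is even, so the two factors [b] meet and
   [b * b = 0]. *)
rewrite /q ed mulrDr !mulrA GiG mul1r !mulrDl -[RHS]add0r; congr (_ + _).
rewrite -!mulrA (mulrA a) (geven_comm b (x := a * t)).
  by rewrite (mulrA b b) godd_sqr // mul0r !mulr0.
by apply/gevenE/(ghomM (b := true) (c := true)); apply/goddE.
Qed.

(** * One change of charts *)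

Lemma gbody_unit (K : numFieldType) n (x : grassmann K n) :
  x \is a GRing.unit -> gbody x != 0.
Proof.
move=> ux; apply/eqP => x0; have := congr1 (@gbody K n) (mulrV ux).
by rewrite gbodyM x0 mul0r gbody1 => /esym/eqP; rewrite oner_eq0.
Qed.

Section Transition.
Variables (R : realType) (N : nat) (D : set (Cplx R)) (z : Cplx R).
Variables (te to : Cplx R -> Lambda R N.+1) (f g alpha beta : Cplx R -> Lambda R N).
Hypotheses (oD : open D) (Dz : D z).
Hypotheses (te_holo : holomorphic_on D te) (to_holo : holomorphic_on D to).
Hypotheses (g_holo : holomorphic_on D g) (beta_holo : holomorphic_on D beta).
Hypothesis f_even : forall u, D u -> geven (f u).
Hypothesis g_even : forall u, D u -> geven (g u).
Hypothesis alpha_odd : forall u, D u -> godd (alpha u).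
Hypothesis beta_odd : forall u, D u -> godd (beta u).
Hypothesis df_unit : gderiv 1 f z \is a GRing.unit.
Hypothesis g_unit : g z \is a GRing.unit.
Local Notation xi0 := (theta (Cplx R) N.+1 N).
Hypothesis toE : forall u, D u ->
  to u = ginc N.+1 (g u) * (xi0 + ginc N.+1 (beta u)).
Hypothesis teE : forall u, D u ->
  te u = gext f (u%:A + xi0 * ginc N.+1 (alpha u)).

Let ginc_godd m (x : Lambda R N) : godd x -> godd (ginc m x).
Proof. by move=> /goddE hx; apply/goddE/ghom_ginc. Qed.

Let ginc_geven m (x : Lambda R N) : geven x -> geven (ginc m x).
Proof. by move=> /gevenE hx; apply/gevenE/ghom_ginc. Qed.

(** [inv_g] is the function [g_{v,v'}] of the transition formula, and [xi0] plays the role of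
    zeta. *)
Definition dual_odd : Lambda R N.+1 :=
  let inv_g := (g z)^-1 in
  let s_a := 1 - inv_g * gderiv 1 (fun u => g u * beta u) z * alpha z in
  ginc N.+1 (inv_g * gderiv 1 f z) * (ginc N.+1 s_a * xi0 - ginc N.+1 (alpha z)).

Definition dual_even : Lambda R N.+1 :=
  gext f (z%:A - (1 - ginc N.+1 (gderiv 1 beta z * alpha z)) * xi0 * ginc N.+1 (beta z)
          + ginc N.+1 (alpha z * beta z)).

Lemma trans_even_expand u : D u ->
  te u = ginc N.+1 (f u) + ginc N.+1 (gderiv 1 f u) * (xi0 * ginc N.+1 (alpha u)).
Proof.
move=> Du; have oa := ginc_godd (m := N.+1) (alpha_odd Du).
rewrite teE // gext_square0 //; last exact: oddM_sqr0 (theta_odd _ _) oa.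
by rewrite gbodyM (gbody_odd oa) mulr0.
Qed.

Lemma forget_last_odd u : D u -> forget_last (to u) = g u * beta u.
Proof.
move=> Du; rewrite toE // /forget_last set_lastM; last exact: godd0.
rewrite set_lastD set_last_theta -!/(forget_last _) !forget_last_ginc.
by rewrite add0r.
Qed.

Lemma forget_last_even u : D u -> forget_last (te u) = f u.
Proof.
move=> Du; rewrite trans_even_expand // /forget_last set_lastD.
rewrite !(set_lastM (@godd0 _ N)) set_last_theta -!/(forget_last _).
by rewrite forget_last_ginc mul0r mulr0 addr0.
Qed.

Lemma gderiv_gbeta : gderiv 1 (fun u => g u * beta u) z
  = gderiv 1 g z * beta z + g z * gderiv 1 beta z.
Proof. by apply: is_gderivE; apply: is_gderivM; apply: holomorphic_is_gderiv Dz. Qed.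

Let df_even : geven (gderiv 1 f z).
Proof. by apply/gevenE/(ghom_gderiv oD Dz) => u Du; apply/gevenE/f_even. Qed.

Let dg_even : geven (gderiv 1 g z).
Proof. by apply/gevenE/(ghom_gderiv oD Dz) => u Du; apply/gevenE/g_even. Qed.

Let dbeta_odd : godd (gderiv 1 beta z).
Proof. by apply/goddE/(ghom_gderiv oD Dz) => u Du; apply/goddE/beta_odd. Qed.

Section Point.
Variables (m : nat) (xi : Lambda R m).
Hypotheses (ltNm : (N < m)%N) (xi_odd : godd xi).
Local Notation zeta := (theta (Cplx R) m N).

Let m_gt0 : (0 < m)%N. Proof. exact: leq_ltn_trans ltNm. Qed.

(** Setting xi to zero in [to] leaves [g beta], which is why the derivative of this product
    appears. *)
Lemma seval_odd_divisor : seval to (z%:A + zeta * xi) xi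
  = ginc m (g z) * (xi + ginc m (beta z))
    + ginc m (gderiv 1 (fun u => g u * beta u) z) * (zeta * xi).
Proof.
rewrite (seval_first_order m_gt0 oD to_holo Dz forget_last_odd (theta_odd _ _) xi_odd).
congr (_ + _); rewrite toE // set_lastM // set_lastD set_last_theta.
by rewrite !set_last_ginc.
Qed.

Lemma seval_even_divisor : seval te (z%:A + zeta * xi) xi
  = ginc m (f z) + ginc m (gderiv 1 f z) * (xi * ginc m (alpha z))
    + ginc m (gderiv 1 f z) * (zeta * xi).
Proof.
rewrite (seval_first_order m_gt0 oD te_holo Dz forget_last_even (theta_odd _ _) xi_odd).
congr (_ + _); rewrite trans_even_expand // set_lastD !(set_lastM xi_odd).
by rewrite set_last_theta !(set_last_ginc xi_odd).
Qed.

(** The displacement in the argument of [f] is an odd multiple of beta, so its square is zero and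
    the Taylor expansion stops at first order. *)
Lemma ginc_dual_even : ginc m dual_even = ginc m (f z) + ginc m (gderiv 1 f z) *
  (- ((1 - ginc m (gderiv 1 beta z) * ginc m (alpha z)) * zeta * ginc m (beta z))
   + ginc m (alpha z) * ginc m (beta z)).
Proof.
rewrite /dual_even -addrA; set d := (X in gext f (_ + X)).
have [k [ok ek]] : exists k, godd k /\ d = k * ginc N.+1 (beta z).
  exists (ginc N.+1 (alpha z) -
      (1 - ginc N.+1 (gderiv 1 beta z * alpha z)) * xi0); split; last first.
    by rewrite /d (gincM _ (alpha z)) [RHS]mulrBl addrC.
  apply/goddE; rewrite -scaleN1r; apply: ghomD.
    exact/ghom_ginc/goddE/alpha_odd.
  apply: ghomZ; apply: (ghomM (b := false) (c := true)); last exact/goddE/theta_odd.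
  rewrite -scaleN1r; apply: ghomD; first exact: ghom1.
  apply/ghomZ/ghom_ginc/(ghomM (b := true) (c := true)); apply/goddE => //.
  exact: alpha_odd.
have ob := ginc_godd (m := N.+1) (beta_odd Dz).
rewrite gext_square0 //; first last.
- by rewrite ek oddM_sqr0.
- by rewrite ek gbodyM (gbody_odd ok) mul0r.
rewrite gincD !gincM !(ginc_comp _ _ (leqnSn N)); congr (_ + _ * _).
rewrite /d gincD gincN !gincM gincB ginc1 gincM.
by rewrite !(ginc_comp _ _ (leqnSn N)) ginc_theta.
Qed.

Lemma ginc_dual_odd : ginc m dual_odd = ginc m (g z)^-1 * ginc m (gderiv 1 f z) *
  ((1 - ginc m (g z)^-1 * ginc m (gderiv 1 (fun u => g u * beta u) z)
        * ginc m (alpha z)) * zeta - ginc m (alpha z)).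
Proof.
have -> (p s a : Lambda R N) :
    ginc m (ginc N.+1 p * (ginc N.+1 s * xi0 - ginc N.+1 a))
      = ginc m p * (ginc m s * zeta - ginc m a).
  rewrite gincM gincB gincM !(ginc_comp _ _ (leqnSn N)).
  by rewrite (ginc_theta _ _ (ltnSn N)).
rewrite [ginc m (_ * gderiv 1 f z)]gincM gincB ginc1.
by rewrite [ginc m (_ * alpha z)]gincM [ginc m (_ * gderiv _ _ z)]gincM.
Qed.

Lemma dual_divisor_equation : seval te (z%:A + zeta * xi) xi
  = ginc m dual_even + ginc m dual_odd * seval to (z%:A + zeta * xi) xi.
Proof.
rewrite seval_even_divisor seval_odd_divisor ginc_dual_even ginc_dual_odd.
rewrite -!addrA; congr (_ + _).
have ViG : ginc m (g z)^-1 * ginc m (g z) = 1 by rewrite -gincM mulVr // ginc1.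
apply: (dual_identity (G1 := ginc m (gderiv 1 g z))) => //.
- exact: ginc_geven.
(* The inverse of a central element is central: insert [g^-1 * g] before [y * g^-1] and move [g]
   past [y]. *)
- move=> y; rewrite /GRing.comm -[RHS]mul1r -ViG -mulrA.
  by rewrite (mulrA _ y) (geven_comm y (ginc_geven (g_even Dz))) -!mulrA -gincM
     mulrV // ginc1 mulr1.
- exact: ginc_geven.
- exact/ginc_godd/alpha_odd.
- exact/ginc_godd/beta_odd.
- exact: ginc_godd.
- exact: theta_odd.
- by rewrite gderiv_gbeta gincD !gincM.
Qed.

(** Subtracting the two equations and factoring by [geval_sub] gives [(U1 - z1 * U2) * (w - p) = 0].
    As [z1] is odd, the first factor has body that of [f'(z)], which is nonzero, and can be
    cancelled. *)
Lemma seval_sub (a1 z1 w : Lambda R m) : godd z1 -> geven w -> gbody w = z ->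
  seval te w xi = a1 + z1 * seval to w xi ->
  seval te (z%:A + zeta * xi) xi = a1 + z1 * seval to (z%:A + zeta * xi) xi ->
  w = z%:A + zeta * xi.
Proof.
move=> oz1 ew bw e1 e2; set p := _ + _.
have ep : geven p.
  apply/gevenE/ghomD; first exact/ghomZ/ghom1.
  by apply: (ghomM (b := true) (c := true)); apply/goddE => //; apply: theta_odd.
have bp : gbody w = gbody p.
  by rewrite bw gbodyD gbody_scalar gbodyM (gbody_odd xi_odd) mulr0 addr0.
have eta_odd := last_subst_odd (N := N) xi_odd.
have [U1 [eU1 bU1]] := geval_sub te m_gt0 eta_odd ew ep bp.
have [U2 [eU2 bU2]] := geval_sub to m_gt0 eta_odd ew ep bp.
have : (U1 - z1 * U2) * (w - p) = 0.
  rewrite mulrBl -mulrA -eU1 -eU2 -!sevalE mulrBr e1 e2.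
  by rewrite opprD addrACA subrr add0r subrr.
(* [mulg_reg] cancels on the right, so the even element [w - p] is moved to the left. *)
rewrite -(geven_comm (U1 - z1 * U2) (x := w - p)); last first.
  by apply/gevenE; rewrite -scaleN1r; apply/ghomD/ghomZ; apply/gevenE.
move/mulg_reg => h; apply/eqP; rewrite -subr_eq0; apply/eqP/h.
rewrite gbodyB gbodyM (gbody_odd oz1) mul0r subr0 bU1 bw.
rewrite -(gbody_set_last (@godd0 _ N)) -/(forget_last _).
by rewrite (gderiv_forget_last oD te_holo Dz forget_last_even) gbody_unit.
Qed.

End Point.

Lemma dual_unique (a1 z1 : Lambda R N.+1) :
  (forall m (xi : Lambda R m), (N < m)%N -> godd xi ->
    let w := z%:A + theta (Cplx R) m N * xi in
    seval te w xi = ginc m a1 + ginc m z1 * seval to w xi) ->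
  z1 = dual_odd /\ a1 = dual_even.
Proof.
(* Two generators beyond the coefficients: index [N] for zeta and index [N.+1] for a free xi. *)
move=> h; set m := N.+2; have ltNm : (N < m)%N by [].
pose da := a1 - dual_even; pose dz := z1 - dual_odd.
have hd (xi : Lambda R m) : godd xi ->
    ginc m da + ginc m dz * seval to (z%:A + theta _ m N * xi) xi = 0.
  move=> oxi; rewrite !gincB mulrBl addrACA -h // -opprD.
  by rewrite -dual_divisor_equation // subrr.
(* [u] is the coefficient of xi in the odd coordinate on the divisor, up to inclusion; its body is
   that of [g z], so it can be cancelled from [dz * u = 0]. *)
pose u := ginc N.+1 (g z) + ginc N.+1 (gderiv 1 (fun u => g u * beta u) z) * xi0.
have h0 := hd 0 (@godd0 _ _).
have := hd (theta _ m N.+1) (theta_odd _ _).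
rewrite -[RHS]h0 => /addrI/eqP; rewrite -subr_eq0 -mulrBr.
rewrite (seval_odd_divisor ltNm (theta_odd _ _)).
rewrite (seval_odd_divisor ltNm (@godd0 _ _)).
have -> x y t e : ginc m (g z) * (x + y) + t * (e * x)
      - (ginc m (g z) * (0 + y) + t * (e * 0)) = (ginc m (g z) + t * e) * x.
  by rewrite !mulr0 add0r addr0 mulrDr [LHS]addrAC addrK mulrDl mulrA.
have -> : ginc m (g z) + ginc m (gderiv 1 (fun u => g u * beta u) z) * theta _ m N
    = ginc m u.
  by rewrite gincD gincM !(ginc_comp _ _ (leqnSn N)) ginc_theta.
rewrite mulrA -gincM => /eqP/ginc_mul_theta_eq0/mulg_reg dz0.
have {}dz0 : dz = 0.
  apply: dz0; rewrite gbodyD gbodyM (gbody_odd (theta_odd _ _)) mulr0 addr0.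
  by rewrite gbody_ginc gbody_unit.
have da0 : da = 0.
  (* With [dz = 0], the equation at [xi = 0] says that the image of [da] vanishes. *)
  apply: ginc_mul_theta_eq0; move: h0; rewrite dz0 ginc0 mul0r addr0 => ->.
  by rewrite mul0r.
by split; apply/eqP; rewrite -subr_eq0; apply/eqP.
Qed.

End Transition.

(** * Duality on all overlaps of the atlas *)

Theorem theorem5p6 (R : realType) (N : nat) (X : topologicalType) (V : Type)
    (A : bodyAtlas R X V) (SF SD : superManifold N A)
    (f g alpha beta : V -> V -> Cplx R -> Lambda R N)
    (f_holo : forall v' v, holomorphic_on (overlap A v' v) (f v' v))
    (g_holo : forall v' v, holomorphic_on (overlap A v' v) (g v' v))
    (alpha_holo : forall v' v, holomorphic_on (overlap A v' v) (alpha v' v))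
    (beta_holo : forall v' v, holomorphic_on (overlap A v' v) (beta v' v))
    (f_even : forall v' v z, overlap A v' v z -> geven (f v' v z))
    (g_even : forall v' v z, overlap A v' v z -> geven (g v' v z))
    (alpha_odd : forall v' v z, overlap A v' v z -> godd (alpha v' v z))
    (beta_odd : forall v' v z, overlap A v' v z -> godd (beta v' v z))
    (df_unit : forall v' v z, overlap A v' v z ->
       gderiv 1 (f v' v) z \is a GRing.unit)
    (g_unit : forall v' v z, overlap A v' v z -> g v' v z \is a GRing.unit)
    (SF_odd : forall v' v z, overlap A v' v z ->
       let xi := theta (Cplx R) N.+1 N in
       trans_odd SF v' v z
         = ginc N.+1 (g v' v z) * (xi + ginc N.+1 (beta v' v z)))
    (SF_even : forall v' v z, overlap A v' v z ->
       let xi := theta (Cplx R) N.+1 N in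
       trans_even SF v' v z
         = gext (f v' v) (z%:A + xi * ginc N.+1 (alpha v' v z))) :
  is_dual SF SD <->
  forall v' v a, overlap A v' v a ->
    let zeta := theta (Cplx R) N.+1 N in
    let inv_g := (g v' v a)^-1 in
    let s_a := 1 - inv_g * gderiv 1 (fun u => g v' v u * beta v' v u) a
                     * alpha v' v a in
    trans_odd SD v' v a
      = ginc N.+1 (inv_g * gderiv 1 (f v' v) a)
        * (ginc N.+1 s_a * zeta - ginc N.+1 (alpha v' v a))
    /\ trans_even SD v' v a
      = gext (f v' v)
          (a%:A
           - (1 - ginc N.+1 (gderiv 1 (beta v' v) a * alpha v' v a))
             * zeta * ginc N.+1 (beta v' v a)
           + ginc N.+1 (alpha v' v a * beta v' v a)).
Proof.
have oD v' v : open (overlap A v' v) by apply: overlap_open.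
have teh v' v : holomorphic_on (overlap A v' v) (trans_even SF v' v).
  exact: trans_even_holo.
have toh v' v : holomorphic_on (overlap A v' v) (trans_odd SF v' v).
  exact: trans_odd_holo.
split=> [dual v' v z Dz | formulas v' v z Dz m ltNm w xi w_even xi_odd Dw].
  apply: (dual_unique (oD v' v) Dz (teh v' v) (toh v' v) (g_holo v' v)
    (beta_holo v' v) (f_even v' v) (g_even v' v) (alpha_odd v' v) (beta_odd v' v)
    (g_unit v' v z Dz) (SF_odd v' v) (SF_even v' v)).
  (* This [w] lies on the divisor of the chart [v] by construction, so duality yields its equation
     in the chart [v']. *)
  move=> m xi ltNm xi_odd w.
  have bw : gbody w = z.
    by rewrite gbodyD gbody_scalar gbodyM (gbody_odd xi_odd) mulr0 addr0.
  have w_even : geven w.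
    apply/gevenE/ghomD; first exact/ghomZ/ghom1.
    by apply: (ghomM (b := true) (c := true)); apply/goddE => //; apply: theta_odd.
  have Dw : overlap A v' v (gbody w) by rewrite bw.
  exact: (dual v' v z Dz m ltNm w xi w_even xi_odd Dw).1.
have eq_odd : trans_odd SD v' v z
    = dual_odd z (f v' v) (g v' v) (alpha v' v) (beta v' v).
  exact: (formulas v' v z Dz).1.
have eq_even : trans_even SD v' v z
    = dual_even z (f v' v) (alpha v' v) (beta v' v).
  exact: (formulas v' v z Dz).2.
have := dual_divisor_equation (oD v' v) Dz (teh v' v) (toh v' v) (g_holo v' v)
  (beta_holo v' v) (f_even v' v) (g_even v' v) (alpha_odd v' v) (beta_odd v' v)
  (g_unit v' v z Dz) (SF_odd v' v) (SF_even v' v) ltNm xi_odd.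
rewrite -eq_odd -eq_even => on_dual.
split=> [-> //|on_w].
have m_gt0 : (0 < m)%N by apply: leq_ltn_trans ltNm.
have z1_odd : godd (ginc m (trans_odd SD v' v z)).
  by apply/goddE/ghom_ginc/goddE/trans_odd_odd.
(* The factorization in [seval_sub] needs equal bodies. The equation in the chart [v'] has an odd
   factor [zeta'], so on bodies it equates the [v']-coordinates of the points over [gbody w] and
   [z]; injectivity of the chart identifies these points. *)
have w_body : gbody w = z.
  have : gbody (trans_even SF v' v (gbody w)) = gbody (trans_even SD v' v z).
    rewrite -(gbody_seval _ _ m_gt0 xi_odd) on_w (gbody_addoM _ _ z1_odd).
    exact: gbody_ginc.
  case: Dz => x [xv xv'] <-; case: Dw => y [yv yv'] <-.
  by rewrite !trans_body // => /(chart_coord_inj yv' xv') ->.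
exact: (seval_sub (oD v' v) Dz (teh v' v) (alpha_odd v' v)
  (df_unit v' v z Dz) (SF_even v' v) ltNm xi_odd z1_odd w_even w_body on_w on_dual).
Qed.
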